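(* Let $\mathcal{A}$ be a subspace arrangement embedded in the braid arrangement $\mathcal{S}_n$. Then \[ \frac{x\,\overline{h}(\mathcal{A},\mathcal{S}_n;x)}{(1-x)^{d(\mathcal{A})+2}}=\sum_{m\geq 0} m\,T(\mathcal{A};m)\,x^m. \]
   Context: The braid arrangement $\mathcal{S}_n$ is the arrangement in the $(n-1)$-dimensional space $V_n=\{(x_1,\dots,x_n)\in\mathbb{R}^n:\sum x_i=0\}$ of the hyperplanes $x_i=x_j$, $1\le i<j\le n$. Its intersection lattice $L_{\mathcal{S}_n}$ consists of all intersections of subfamilies of these hyperplanes, ordered by reverse inclusion. A subspace arrangement $\mathcal{A}$ (finite set of linear subspaces, none containing another) is embedded in $\mathcal{S}_n$ if it is an antichain in $L_{\mathcal{S}_n}$. $\Delta_{\mathcal{S}_n}$ is the simplicial decomposition of the unit sphere of $V_n$ whose cells are the sets of points with a common sign vector with respect to the hyperplanes of $\mathcal{S}_n$, and $\Delta_{\mathcal{A},\mathcal{S}_n}$ is its subcomplex formed by $(\bigcup\mathcal{A})$ intersected with the unit sphere. $d(\mathcal{A})=\max_{A\in\mathcal{A}}\dim A$, so $\Delta_{\mathcal{A},\mathcal{S}_n}$ has dimension $d(\mathcal{A})-1$. For a simplicial complex $\Delta$ of dimension $d-1$, $h(\Delta;x)=\sum_{i=0}^d f_{i-1}(x-1)^{d-i}$ ($f_i$ = number of $i$-faces, $f_{-1}=1$ if nonempty), $\overline{h}(\Delta;x)=x^dh(\Delta;1/x)$, and $\overline{h}(\mathcal{A},\mathcal{S}_n;x)=\overline{h}(\Delta_{\mathcal{A},\mathcal{S}_n};x)$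 (taken to be $0$ if $\mathcal{A}=\emptyset$). The characteristic polynomial of $\mathcal{A}$ (as an arrangement in $V_n$) is $\chi(\mathcal{A};x)=\sum_{Y\in L_\mathcal{A}}\mu(V_n,Y)x^{\dim Y}$, where $L_\mathcal{A}$ is the lattice of intersections of subfamilies of $\mathcal{A}$ (least element $V_n$) ordered by reverse inclusion and $\mu$ its Möbius function. The tail is $T(\mathcal{A};x)=x^{n-1}-\chi(\mathcal{A};x)$.
   Formalization: The formal statement adds that V_n itself is not a member of the arrangement; for the arrangement {V_n} the tail is 0 while the left side is nonzero (n=2: x(1+x)/(1-x)^3), so the formula fails there. *)

(* Defs.v *)
From HB Require Import structures.
From mathcomp Require Import all_boot all_order all_algebra.
From mathcomp Require Import finmap.
From mathcomp Require Import boolp classical_sets functions cardinality reals.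

Set Implicit Arguments.
Unset Strict Implicit.
Unset Printing Implicit Defensive.

Import Order.TTheory GRing.Theory Num.Theory.

Local Open Scope classical_set_scope.
Local Open Scope ring_scope.

Section FinitePoset.
Context {T : choiceType}.

(* mu(x, x) = 1 and mu(x, y) = - \sum_(x <= z < y) mu(x, z) in the finite poset
   (P, le); the fuel k bounds the length of the recursion, see [mobius_sum]. *)
Fixpoint mobius_rec (P : {fset T}) (le : rel T) (k : nat) (x y : T) : int :=
  if k is k'.+1 then
    if x == y then 1
    else - \sum_(z <- P | [&& le x z, le z y & z != y]) mobius_rec P le k' x z
  else 0.

Definition mobius (P : {fset T}) (le : rel T) (x y : T) : int :=
  mobius_rec P le #|` P|.+1 x y.

Lemma mobius_rec_fuel (P : {fset T}) (le : rel T) :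
  transitive le -> antisymmetric le -> forall k k' x y,
  (count (fun z => le z y && (z != y)) P < k)%N ->
  (count (fun z => le z y && (z != y)) P < k')%N ->
  mobius_rec P le k x y = mobius_rec P le k' x y.
Proof.
move=> tr an; elim=> [|k IH] [|k'] x y //= hk hk'.
case: eqP => // _; congr (- _).
rewrite big_seq_cond [RHS]big_seq_cond; apply: eq_bigr => z.
case/andP=> zP /and3P[xz zy zny].
have lt : (count (fun w => le w z && (w != z)) P
           < count (fun w => le w y && (w != y)) P)%N.
  have -> : count (fun w => le w y && (w != y)) P =
    (count (fun w => [&& le w y, w != y & w != z]) P + 1)%N.
    rewrite -[LHS]size_filter -(count_predC (pred1 z)) addnC !count_filter.
    congr addn; first by apply: eq_count => w /=; rewrite andbC andbA.
    rewrite -[RHS](_ : count_mem z P = 1%N); last first.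
      by rewrite count_uniq_mem ?zP// fset_uniq.
    by apply: eq_count => w /=; case: eqP => // ->; rewrite zy zny.
  rewrite addn1 ltnS; apply: sub_count => w /= /andP[wz wnz].
  rewrite (tr _ _ _ wz zy) wnz andbT /=; apply: contraNneq wnz => wy.
  by apply/eqP/an; rewrite wz wy zy.
by apply: IH; [rewrite -ltnS | rewrite -ltnS]; apply: leq_ltn_trans lt _.
Qed.

Lemma mobius_diag (P : {fset T}) (le : rel T) x : mobius P le x x = 1.
Proof. by rewrite /mobius /= eqxx. Qed.

Lemma mobius_sum (P : {fset T}) (le : rel T) : reflexive le ->
  transitive le -> antisymmetric le -> forall x y, y \in P -> le x y -> x != y ->
  \sum_(z <- P | le x z && le z y) mobius P le x z = 0.
Proof.
move=> re tr an x y yP xy nxy.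
rewrite -big_filter (bigD1_seq y) /=; last by rewrite filter_uniq ?fset_uniq.
  2: by rewrite mem_filter xy re.
rewrite big_filter_cond.
rewrite {1}/mobius /= (negPf nxy).
rewrite addrC; apply/eqP; rewrite subr_eq0; apply/eqP.
rewrite big_seq_cond [RHS]big_seq_cond.
rewrite (eq_bigl (fun z => (z \in P) && [&& le x z, le z y & z != y])); last first.
  by move=> z /=; rewrite !andbA.
apply: eq_bigr => z /andP[zP /and3P[xz zy zny]].
have c : (count (fun w => le w z && (w != z)) P < #|` P|)%N.
  rewrite /= -(count_predC (fun w => le w z && (w != z)) (enum_fset P)) -addn1 leq_add2l.
  by rewrite -has_count; apply/hasP; exists z => //=; rewrite eqxx andbF.
by apply: mobius_rec_fuel => //; rewrite ltnS ltnW.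
Qed.

End FinitePoset.

Section Series.

(* The power series [\sum_m c m x^m] is the expansion of p / q, that is, its
   Cauchy product with q is p. *)
Definition expansion (p q : {poly int}) (c : nat -> int) : Prop :=
  forall N : nat, \sum_(i < N.+1) q`_i * c (N - i)%N = p`_N.

Lemma expansion_unique (p q : {poly int}) (c c' : nat -> int) :
  q`_0 != 0 -> expansion p q c -> expansion p q c' -> c =1 c'.
Proof.
move=> q0 hc hc' N; elim/ltn_ind: N => N IH.
have := hc N; rewrite -(hc' N) !big_ord_recl subn0 /=.
rewrite [X in _ + X = _](eq_bigr (fun i : 'I_N => q`_(bump 0 i) * c' (N - bump 0 i)%N)).
  by move/addIr/(mulfI q0).
move=> i _; rewrite IH // /bump /= add1n; case: N i {IH} => [[]//|N i].
by rewrite subSS ltnS leq_subr.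
Qed.

(* The polynomial x^d p(1/x), for deg p <= d. *)
Definition reverse_poly (d : nat) (p : {poly int}) : {poly int} :=
  \poly_(i < d.+1) p`_(d - i).

Lemma reverse_polyE (F : fieldType) (d : nat) (p : {poly int}) (x : F) :
  (size p <= d.+1)%N -> x != 0 ->
  (map_poly intr (reverse_poly d p)).[x] =
  x ^+ d * (map_poly intr p).[x^-1].
Proof.
move=> sp x0.
rewrite (@horner_coef_wide _ d.+1); last first.
  by rewrite (leq_trans (size_poly _ _)) // size_poly.
rewrite (@horner_coef_wide _ d.+1 (map_poly _ p)); last first.
  by rewrite (leq_trans (size_poly _ _)).
rewrite mulr_sumr (reindex_inj rev_ord_inj) /=; apply: eq_bigr => i _.
have id : (i <= d)%N by rewrite -ltnS.
rewrite !coef_map /= coef_poly subSS ltnS leq_subr subKn // mulrCA; congr (_ * _).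
have -> : x ^+ d = x ^+ (d - i) * x ^+ i by rewrite -exprD subnK.
by rewrite exprVn mulfK // expf_neq0.
Qed.

End Series.

Section BraidArrangement.
Variables (R : realType) (n : nat).

Local Notation space := {vspace 'rV[R]_n}.

Definition coord_sum (x : 'rV[R]_n) : R^o := \sum_i x 0 i.
Definition coord_diff (i j : 'I_n) (x : 'rV[R]_n) : R^o := x 0 i - x 0 j.

Definition braid_space : space := lker (linfun coord_sum).

Definition braid_hyperplane (i j : 'I_n) : space :=
  (braid_space :&: lker (linfun (coord_diff i j)))%VS.

Lemma mem_braid_space x : (x \in braid_space) = (\sum_i x 0 i == 0).
Proof.
have lin : linear coord_sum.
  move=> a u v; rewrite /coord_sum scaler_sumr -big_split /=.
  by apply: eq_bigr => i _; rewrite !mxE.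
pose f : {linear 'rV[R]_n -> R^o} :=
  HB.pack coord_sum (GRing.isLinear.Build _ _ _ _ _ lin).
by rewrite memv_ker (lfunE f).
Qed.

Lemma mem_braid_hyperplane i j x :
  (x \in braid_hyperplane i j) = (\sum_i x 0 i == 0) && (x 0 i == x 0 j).
Proof.
have lin : linear (coord_diff i j).
  by move=> a u v; rewrite /coord_diff !mxE scalerBr opprD addrACA.
pose f : {linear 'rV[R]_n -> R^o} :=
  HB.pack (coord_diff i j) (GRing.isLinear.Build _ _ _ _ _ lin).
by rewrite memv_cap mem_braid_space memv_ker (lfunE f) subr_eq0.
Qed.

Definition braid_arrangement : {fset space} :=
  [fset braid_hyperplane p.1 p.2 | p in {: 'I_n * 'I_n} & (p.1 < p.2)%N]%fset.

Definition intersection_lattice (A : {fset space}) : {fset space} :=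
  [fset (braid_space :&: \bigcap_(X <- B) X)%VS | B : {fset space} in fpowerset A]%fset.

Definition subspace_arrangement (A : {fset space}) : Prop :=
  {in A &, forall X Y, (X <= Y)%VS -> X = Y}.

Definition embedded_in_braid (A : {fset space}) : Prop :=
  subspace_arrangement A /\ (A `<=` intersection_lattice braid_arrangement)%fset.

Definition arrangement_dim (A : {fset space}) : nat := \max_(X <- A) \dim X.

Definition reverse_inclusion : rel space := fun X Y => (Y <= X)%VS.

Definition char_poly_arr (A : {fset space}) : {poly int} :=
  let L := intersection_lattice A in
  \sum_(Y <- L) mobius L reverse_inclusion braid_space Y *: 'X^(\dim Y).

Definition tail (A : {fset space}) : {poly int} :=
  'X^(n.-1) - char_poly_arr A.

Definition unit_sphere : set 'rV[R]_n :=
  [set x | x \in braid_space /\ \sum_i x 0 i ^+ 2 = 1].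

Definition same_signs (x y : 'rV[R]_n) : Prop :=
  forall i j : 'I_n, (i < j)%N ->
    Num.sg (x 0 i - x 0 j) = Num.sg (y 0 i - y 0 j).

Definition sphere_cells : set (set 'rV[R]_n) :=
  [set C | exists2 x, unit_sphere x & C = unit_sphere `&` same_signs x].

(* Faces, as sets of points of the sphere: the empty face and the cells. *)
Definition braid_complex : set (set 'rV[R]_n) := set0 |` sphere_cells.

Definition link_complex (A : {fset space}) : set (set 'rV[R]_n) :=
  braid_complex `&` [set C | C `<=` [set x | exists2 X, X \in A & x \in X]].

(* Dimension of the linear span of C. A face of dimension k of a simplicial
   decomposition of a sphere centred at 0 spans a space of dimension k + 1;
   the empty face, of dimension -1, spans 0. *)
Definition span_dim (C : set 'rV[R]_n) : nat :=
  \max_(k < n.+1 | `[< exists s : k.-tuple 'rV[R]_n,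
                         free s /\ forall v, v \in s -> C v >]) k.

(* [num_faces D k] is f_(k-1) and [complex_rank D] is dim D + 1. *)
Definition num_faces (D : set (set 'rV[R]_n)) (k : nat) : nat :=
  #|` fset_set (D `&` [set C | span_dim C = k])|.

Definition complex_rank (D : set (set 'rV[R]_n)) : nat :=
  \max_(C <- fset_set D) span_dim C.

Definition h_poly (D : set (set 'rV[R]_n)) : {poly int} :=
  let d := complex_rank D in
  \sum_(i < d.+1) (num_faces D i)%:R *: ('X - 1) ^+ (d - i).

Definition hbar_poly (D : set (set 'rV[R]_n)) : {poly int} :=
  reverse_poly (complex_rank D) (h_poly D).

Definition hbar_arr (A : {fset space}) : {poly int} :=
  if A == fset0 then 0 else hbar_poly (link_complex A).

(* [fset_set] is meaningful on finite sets only. *)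
Lemma finite_braid_complex : finite_set braid_complex.
Proof.
rewrite /braid_complex finite_setU; split; first exact: finite_set1.
pose pat (x : 'rV[R]_n) : {ffun 'I_n * 'I_n -> bool} :=
  [ffun p => x 0 p.1 <= x 0 p.2].
pose cell (s : {ffun 'I_n * 'I_n -> bool}) : set 'rV[R]_n :=
  unit_sphere `&` [set y | exists2 x, pat x = s & same_signs x y].
apply: (@sub_finite_set _ _ (cell @` setT)); last exact/finite_image/finite_finset.
move=> _ [x sx ->]; exists (pat x) => //.
apply/seteqP; split=> y [sy xy]; split=> //; last by exists x.
case: xy => z zx zy i j ij; rewrite -(zy i j ij).
have e p q : (z 0 p <= z 0 q) = (x 0 p <= x 0 q).
  by have /ffunP/(_ (p, q)) := zx; rewrite !ffunE.
have l p q : (z 0 p < z 0 q) = (x 0 p < x 0 q) by rewrite !ltNge e.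
have [h|h|h] := ltgtP (x 0 i) (x 0 j).
- by rewrite !ltr0_sg // subr_lt0 // l.
- by rewrite !gtr0_sg // subr_gt0 // l.
- suff -> : z 0 i = z 0 j by rewrite h !subrr.
  by apply/eqP; rewrite eq_le !e h lexx.
Qed.

End BraidArrangement.

(* Main.v *)
Require Import Defs.
From mathcomp Require Import all_boot all_order all_algebra.
From mathcomp Require Import finmap.
From mathcomp Require Import boolp classical_sets functions cardinality reals.
From mathcomp Require Import zify ring.

Set Implicit Arguments.
Unset Strict Implicit.
Unset Printing Implicit Defensive.

Import Order.TTheory GRing.Theory Num.Theory.

Local Open Scope ring_scope.

(* Count in two ways the points of {0, ..., m-1}^n whose projection to V along
   (1, ..., 1) lies in the union of A. A flat Y of dimension d contains the
   projections of m^(d+1) of them, so Moebius inversion over L_A gives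
   m T(A; m). On the other hand, a cell spanning a space of dimension i is an
   ordering of i+1 blocks of coordinates, hence contains the projections of
   binomial(m, i+1) of them up to scaling (the empty face accounts for the
   constant points), which gives \sum_i f_(i-1) binomial(m, i+1). The generating
   function of binomial(m, i+1) is x^(i+1) / (1-x)^(i+2), and
   hbar = \sum_i f_(i-1) x^i (1-x)^(d-i). *)

(** * Rational generating functions *)

(** Coefficient [N] of a product sees only coefficients up to [N], so any truncation of the series
    beyond [N] serves and the ring laws of polynomials become available. *)
Lemma expansionE (p q : {poly int}) (c : nat -> int) :
  expansion p q c <->
  forall M N, (N < M)%N -> (q * \poly_(i < M) c i)`_N = p`_N.
Proof.
have coefE M N : (N < M)%N -> (q * \poly_(i < M) c i)`_N =
    \sum_(i < N.+1) q`_i * c (N - i)%N.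
  move=> NM; rewrite coefM; apply: eq_bigr => i _.
  by rewrite coef_poly (leq_ltn_trans (leq_subr _ _) NM).
split=> [h M N NM|h N]; first by rewrite coefE.
by rewrite -(coefE N.+1) // h.
Qed.

Lemma expansion_mull (r p q : {poly int}) c :
  expansion p q c -> expansion (r * p) (r * q) c.
Proof.
move/expansionE=> h; apply/expansionE => M N NM.
rewrite -mulrA !coefM; apply: eq_bigr => i _; congr (_ * _).
by rewrite h // (leq_ltn_trans (leq_subr _ _) NM).
Qed.

Lemma expansion_sum (I : Type) (r : seq I) (p : I -> {poly int}) q
    (c : I -> nat -> int) :
  (forall i, expansion (p i) q (c i)) ->
  expansion (\sum_(i <- r) p i) q (fun m => \sum_(i <- r) c i m).
Proof.
move=> h N; rewrite coef_sum.
under eq_bigr do rewrite mulr_sumr.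
by rewrite exchange_big; apply: eq_bigr => i _; exact: h.
Qed.

Lemma expansion_scale a p q c :
  expansion p q c -> expansion (a *: p) q (fun m => a * c m).
Proof.
move=> h N; rewrite coefZ -h mulr_sumr.
by apply: eq_bigr => i _; rewrite mulrCA.
Qed.

(** By Pascal's rule, multiplying the series of ['C(m, j.+1)] by [1 - 'X] gives ['X] times the
    series of ['C(m, j)]; induction on [j] follows. *)
Lemma expansion_bin j :
  expansion 'X^j ((1 - 'X) ^+ j.+1) (fun m => 'C(m, j)%:R).
Proof.
elim: j => [|j /expansionE IH]; apply/expansionE => M N NM.
  rewrite expr1 mulrBl mul1r coefB coefXM !coef_poly NM coefXn !bin0.
  by case: N NM => [|N] NM //=; rewrite (ltnW NM) subrr.
have -> : ((1 - 'X) ^+ j.+2 * \poly_(i < M) 'C(i, j.+1)%:R)`_N =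
    ('X * ((1 - 'X) ^+ j.+1 * \poly_(i < M) 'C(i, j)%:R))`_N :> int.
  rewrite [_ ^+ j.+2]exprSr -mulrA ['X * _]mulrCA !coefM.
  apply: eq_bigr => i _; congr (_ * _).
  have : (N - i < M)%N by rewrite (leq_ltn_trans (leq_subr _ _) NM).
  move: (N - i)%N => k kM.
  rewrite mulrBl mul1r coefB !coefXM !coef_poly kM.
  case: k kM => [|k] kM; first by rewrite subrr.
  by rewrite /= (ltnW kM) binS natrD addrAC subrr add0r.
rewrite coefXM coefXn; case: N NM => //= N NM.
by rewrite IH ?coefXn // ltnW.
Qed.

(** Reversal is multiplicative when degree bounds add up, and ['X - 1], with bound 1, reverses to
    [1 - 'X]. *)
Lemma reverse_poly_mulXsub1 d (p : {poly int}) : (size p <= d.+1)%N ->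
  reverse_poly d.+1 (p * ('X - 1)) = reverse_poly d p * (1 - 'X).
Proof.
move=> sp; apply/polyP=> l.
rewrite mulrBr mulr1 mulrBr mulr1 coefB coefMX /reverse_poly !coef_poly.
rewrite coefB coefMX.
(* The constant term involves the coefficient of degree [d.+1] of [p], which the size bound makes
   0. *)
case: l => [|l] /=; first by rewrite !subn0 [p`_d.+1]nth_default ?subr0.
rewrite !ltnS subSS; case: (ltngtP l d) => ld.
- by rewrite subn_eq0 leqNgt ld /= subnS.
- by rewrite subr0.
- by rewrite ld subnn /= !sub0r.
Qed.

Lemma reverse_poly_Xsub1_exp i k :
  reverse_poly (i + k) (('X - 1) ^+ k) = 'X^i * (1 - 'X) ^+ k.
Proof.
elim: k => [|k IH].
  rewrite !expr0 mulr1 addn0; apply/polyP=> l.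
  rewrite coef_poly coefXn coef1 ltnS; case: ltngtP => li.
  - by rewrite subn_eq0 leqNgt li.
  - by [].
  - by rewrite li subnn.
rewrite addnS [in LHS]exprSr reverse_poly_mulXsub1 ?IH -?mulrA -?exprSr //.
by rewrite -[1]polyC1 size_exp_XsubC ltnS leq_addl.
Qed.

Lemma hbar_polyE (R : realType) n (D : set (set 'rV[R]_n)) :
  let d := complex_rank D in
  hbar_poly D =
  \sum_(i < d.+1) (num_faces D i)%:R *: ('X^i * (1 - 'X) ^+ (d - i)).
Proof.
move=> d; rewrite /hbar_poly /h_poly -/d.
transitivity (\sum_(i < d.+1)
    (num_faces D i)%:R *: reverse_poly d (('X - 1) ^+ (d - i))).
  apply/polyP=> l; rewrite coef_poly coef_sum.
  case: ifP => ld; rewrite ?coef_sum.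
    by apply: eq_bigr => i _; rewrite !coefZ coef_poly ld.
  by rewrite big1 // => i _; rewrite coefZ coef_poly ld mulr0.
apply: eq_bigr => i _; congr (_ *: _).
by rewrite -reverse_poly_Xsub1_exp subnKC // -ltnS.
Qed.

Lemma expansion_hbar (R : realType) n (D : set (set 'rV[R]_n)) :
  let d := complex_rank D in
  expansion ('X * hbar_poly D) ((1 - 'X) ^+ (d + 2))
    (fun m => \sum_(i < d.+1) (num_faces D i)%:R * 'C(m, i.+1)%:R).
Proof.
move=> d; rewrite hbar_polyE -/d mulr_sumr.
apply: expansion_sum => i; rewrite -scalerAr; apply: expansion_scale.
(* The factor [(1 - 'X) ^+ (d - i)] is common to both sides of the fraction; what remains is the
   binomial series for [i.+1]. *)
have -> : (d + 2 = d - i + i.+2)%N by have := ltn_ord i; lia.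
rewrite mulrA -exprS mulrC exprD.
exact/expansion_mull/expansion_bin.
Qed.

(** * Flats of the braid arrangement *)

Lemma memv_bigcap_seq (K : fieldType) (vT : vectType K) (v : vT)
    (s : seq {vspace vT}) :
  (v \in \bigcap_(X <- s) X)%VS = all (fun X : {vspace vT} => v \in X) s.
Proof.
by elim: s => [|X s IH]; rewrite ?big_nil ?memvf // big_cons memv_cap IH.
Qed.

Section BraidFlats.
Context {R : realType} {n : nat}.
Implicit Types (x y u w : 'rV[R]_n) (X Y : {vspace 'rV[R]_n}).

Local Notation V := (braid_space R n).

(** The sign of a difference amounts to two strict comparisons, so a sign vector is a weak ordering
    of the coordinates. *)
Lemma same_signsP x y :
  same_signs x y <-> forall i j, (x 0 i < x 0 j) = (y 0 i < y 0 j).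
Proof.
have sgE (a b c d : R) : Num.sg (a - b) = Num.sg (c - d) <->
    ((a < b) = (c < d)) /\ ((b < a) = (d < c)).
  split=> [h|[]].
    by rewrite -[a < b]subr_lt0 -[c < d]subr_lt0 -[b < a]subr_gt0
               -[d < c]subr_gt0 -!sgr_cp0 h.
  rewrite -[a < b]subr_lt0 -[c < d]subr_lt0 -[b < a]subr_gt0 -[d < c]subr_gt0.
  by move: (a - b) (c - d) => p q; rewrite !sgr_def !neq_lt => -> ->.
split=> [h i j|h i j ij]; last by apply/sgE; split; exact: h.
case: (ltngtP i j) => [ij|ji|/ord_inj ->]; last by rewrite !ltxx.
  by have /sgE[] := h i j ij.
by have /sgE[] := h j i ji.
Qed.

Lemma same_signs_refl x : same_signs x x.
Proof. by []. Qed.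

Lemma same_signs_sym x y : same_signs x y -> same_signs y x.
Proof. by move=> h i j ij; rewrite h. Qed.

Lemma same_signs_trans x y w :
  same_signs x y -> same_signs y w -> same_signs x w.
Proof. by move=> h h' i j ij; rewrite h ?h'. Qed.

Lemma same_signs_eq x y i j :
  same_signs x y -> (x 0 i == x 0 j) = (y 0 i == y 0 j).
Proof. by move/same_signsP=> h; rewrite !eq_le !leNgt !h. Qed.

Lemma same_signsZ a x : 0 < a -> same_signs x (a *: x).
Proof. by move=> a0; apply/same_signsP => i j; rewrite !mxE ltr_pM2l. Qed.

Lemma braid_space_const x :
  x \in V -> (forall i j, x 0 i = x 0 j) -> x = 0.
Proof.
rewrite mem_braid_space => /eqP s0 h; apply/rowP => i; rewrite mxE.
have : \sum_(j < n) x 0 j = x 0 i *+ n.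
  by rewrite (eq_bigr (fun=> x 0 i)) ?sumr_const ?card_ord.
rewrite s0 => /esym/eqP; rewrite mulrn_eq0 => /orP[/eqP n0|/eqP //].
by have := ltn_ord i; rewrite {2}n0.
Qed.

Lemma same_signs0 x : x \in V -> same_signs 0 x -> x = 0.
Proof.
move=> xV h; apply: braid_space_const => // i j.
by apply/eqP; rewrite -(same_signs_eq i j h) !mxE.
Qed.

(** The orthogonal projection onto [V]; it keeps all differences of coordinates. *)
Definition center u : 'rV[R]_n :=
  u - const_mx ((\sum_i u 0 i) / n%:R).

Lemma center_lt u i j : (center u 0 i < center u 0 j) = (u 0 i < u 0 j).
Proof. by rewrite !mxE ltrD2r. Qed.

Lemma center_eq u i j : (center u 0 i == center u 0 j) = (u 0 i == u 0 j).
Proof. by rewrite !mxE (inj_eq (addIr _)). Qed.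

Lemma center_braid u : (0 < n)%N -> center u \in V.
Proof.
move=> n0; rewrite mem_braid_space; under eq_bigr do rewrite !mxE.
rewrite sumrB sumr_const card_ord -[_ / _ *+ n]mulr_natr divfK ?subrr //.
by rewrite pnatr_eq0 -lt0n.
Qed.

(* The least flat of the braid arrangement through [x]. *)
Definition flat_of x : {vspace 'rV[R]_n} :=
  (V :&: \bigcap_(p : 'I_n * 'I_n | (x 0 p.1 == x 0 p.2)%R)
           braid_hyperplane R p.1 p.2)%VS.

Lemma flat_ofP x y :
  reflect (y \in V /\ forall i j, x 0 i = x 0 j -> y 0 i = y 0 j)
          (y \in flat_of x).
Proof.
rewrite memv_cap; apply: (iffP andP) => [[yV hy]|[yV h]]; split=> //.
  move: hy; rewrite memvE => /subv_bigcapP h i j /eqP xij.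
  by have := h (i, j) xij; rewrite -memvE mem_braid_hyperplane => /andP[_ /eqP].
rewrite memvE; apply/subv_bigcapP => -[i j] /= /eqP xij.
by rewrite -memvE mem_braid_hyperplane -mem_braid_space yV (h i j xij) eqxx.
Qed.

Lemma flat_of_sub x : (flat_of x <= V)%VS.
Proof. exact: capvSl. Qed.

Lemma flat_of_id x : x \in V -> x \in flat_of x.
Proof. by move=> xV; apply/flat_ofP. Qed.

Lemma flat_of_min x y : y \in flat_of x -> (flat_of y <= flat_of x)%VS.
Proof.
case/flat_ofP=> _ h; apply/subvP => w /flat_ofP[wV hw].
by apply/flat_ofP; split=> // i j /h/hw.
Qed.

Lemma flat_of_same_signs x y w : same_signs y w -> w \in V ->
  y \in flat_of x -> w \in flat_of x.
Proof.
move=> yw wV /flat_ofP[_ h]; apply/flat_ofP; split=> // i j /h/eqP.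
by rewrite (same_signs_eq i j yw) => /eqP.
Qed.

(** For a subspace of [V], this says that it is cut out by the hyperplanes containing it, in a form
    that passes directly to intersections. *)
Definition equality_closed X : Prop :=
  forall y, y \in V ->
    (forall i j, (forall z, z \in X -> z 0 i = z 0 j) -> y 0 i = y 0 j) ->
  y \in X.

Lemma equality_closed_hyperplane i j :
  equality_closed (braid_hyperplane R i j).
Proof.
move=> y yV h; rewrite mem_braid_hyperplane -mem_braid_space yV /=.
by apply/eqP/h => z; rewrite mem_braid_hyperplane => /andP[_ /eqP].
Qed.

Lemma equality_closed_bigcap (s : seq {vspace 'rV[R]_n}) :
  {in s, forall X, equality_closed X} ->
  equality_closed (V :&: \bigcap_(X <- s) X)%VS.
Proof.
move=> hs y yV h; rewrite memv_cap yV memv_bigcap_seq.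
apply/allP => X Xs; apply: hs => // i j hX; apply: h => z.
by rewrite memv_cap memv_bigcap_seq => /andP[_ /allP/(_ X Xs)/hX].
Qed.

Lemma equality_closed_flat_of X : (0 < n)%N -> (X <= V)%VS ->
  equality_closed X -> exists2 x, x \in V & X = flat_of x.
Proof.
move=> n0 XV cX.
pose e i j := `[< forall z, z \in X -> z 0 i = z 0 j >].
have eP i j : reflect (forall z, z \in X -> z 0 i = z 0 j) (e i j).
  exact: asboolP.
(* A generic point of [X] is built by numbering the classes of [e]: its coordinates agree exactly
   where all points of [X] force them to. *)
pose r i := enum_rank [set j | e i j].
have rP i j : (r i == r j) = e i j.
  rewrite (inj_eq enum_rank_inj); apply/eqP/idP => [/setP/(_ j)|/eP eij].
    by rewrite !inE => ->; apply/eP.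
  apply/setP => k; rewrite !inE; apply/eP/eP => h z zX.
    by rewrite -eij // h.
  by rewrite eij // h.
pose u : 'rV[R]_n := \row_i (r i)%:R.
have uP i j : (center u 0 i == center u 0 j) = e i j.
  by rewrite center_eq !mxE eqr_nat -rP.
exists (center u); first exact: center_braid.
apply/vspaceP => y; apply/idP/flat_ofP => [yX|[yV h]].
  split; first exact: (subvP XV).
  by move=> i j /eqP; rewrite uP => /eP; apply.
by apply: cX => // i j /eP; rewrite -uP => /eqP/h.
Qed.

Lemma intersection_latticeP (A : {fset {vspace 'rV[R]_n}}) Y :
  reflect (exists2 B : {fset {vspace 'rV[R]_n}}, (B `<=` A)%fset &
             Y = (V :&: \bigcap_(X <- B) X)%VS)
          (Y \in intersection_lattice A).
Proof.
apply: (iffP (imfsetP _ _ _ _)) => /= -[B].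
  by rewrite fpowersetE => BA ->; exists B.
by move=> BA ->; exists B; rewrite // fpowersetE.
Qed.

Lemma embedded_equality_closed (A : {fset {vspace 'rV[R]_n}}) X :
  embedded_in_braid A -> X \in A -> equality_closed X.
Proof.
case=> _ /fsubsetP AL /AL/intersection_latticeP[B /fsubsetP BS ->].
apply: equality_closed_bigcap => H /BS/imfsetP[[i j] /= _ ->].
exact: equality_closed_hyperplane.
Qed.

Lemma embedded_flat_of (A : {fset {vspace 'rV[R]_n}}) X : (0 < n)%N ->
  embedded_in_braid A -> X \in A -> exists2 x, x \in V & X = flat_of x.
Proof.
move=> n0 Ae XA; apply: equality_closed_flat_of => //; last first.
  exact: embedded_equality_closed Ae XA.
by case: Ae => _ /fsubsetP/(_ _ XA)/intersection_latticeP[B _ ->];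
  exact: capvSl.
Qed.

Lemma lattice_flat_of (A : {fset {vspace 'rV[R]_n}}) Y : (0 < n)%N ->
  embedded_in_braid A -> Y \in intersection_lattice A ->
  exists2 x, x \in V & Y = flat_of x.
Proof.
move=> n0 Ae /intersection_latticeP[B /fsubsetP BA ->].
apply: equality_closed_flat_of => //; first exact: capvSl.
by apply: equality_closed_bigcap => X /BA; exact: embedded_equality_closed.
Qed.

(** The ordered block partition of a point: [rho] ranks the [k.+1] distinct coordinate values, and
    [sigma] picks a coordinate in each block. *)
Lemma rank_coords x : (0 < n)%N ->
  exists k (rho : 'I_n -> 'I_k.+1) (sigma : 'I_k.+1 -> 'I_n),
    cancel sigma rho /\ forall i j, (rho i < rho j)%N = (x 0 i < x 0 j).
Proof.
move=> n0; pose s := sort <=%O (undup (codom (x 0))).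
have ms i : x 0 i \in s by rewrite mem_sort mem_undup codom_f.
have ss : sorted <%O s by rewrite sort_lt_sorted undup_uniq.
have us : uniq s by exact: lt_sorted_uniq.
have [k sk] : exists k, size s = k.+1.
  by case: (s) (ms (Ordinal n0)) => // a l _; exists (size l).
have rk i : (index (x 0 i)%R s < k.+1)%N by rewrite -sk index_mem.
have ex (a : 'I_k.+1) : exists i, index (x 0 i) s == a.
  have : nth 0 s a \in s by rewrite mem_nth // sk.
  rewrite mem_sort mem_undup => /codomP[i xi]; exists i.
  by rewrite -xi index_uniq // sk.
exists k, (fun i => Ordinal (rk i)), (fun a => xchoose (ex a)); split.
  by move=> a; apply/val_inj/eqP/(xchooseP (ex a)).
move=> i j /=; rewrite -(lt_sorted_ltn_nth 0 ss) ?inE ?index_mem //.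
by rewrite !nth_index.
Qed.

Lemma rank_coords_eq x k (rho : 'I_n -> 'I_k) :
  (forall i j, (rho i < rho j)%N = (x 0 i < x 0 j)) ->
  forall i j, (rho i == rho j) = (x 0 i == x 0 j).
Proof.
by move=> h i j; rewrite [x 0 i == _]eq_le !leNgt -!h -val_eqE; case: ltngtP.
Qed.

End BraidFlats.

(** * Counting grid points *)

Section Counting.
Context {R : realType} {n : nat} (n_gt0 : (0 < n)%N).
Implicit Types (x y u w : 'rV[R]_n) (X Y : {vspace 'rV[R]_n}).

Local Notation V := (braid_space R n).

(** The vectors constant on the [k.+1] blocks form the direct sum of the flat and the line through
    (1, ..., 1). *)
Lemma dim_flat_of_rank x k (rho : 'I_n -> 'I_k.+1) (sigma : 'I_k.+1 -> 'I_n) :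
  cancel sigma rho ->
  (forall i j, (rho i < rho j)%N = (x 0 i < x 0 j)) ->
  \dim (flat_of x) = k.
Proof.
move=> sK h; have he := rank_coords_eq h.
(* The incidence matrix of blocks and coordinates; [phi] spreads one value per block over the
   coordinates. *)
pose P : 'M[R]_(k.+1, n) := \matrix_(a, i) (rho i == a)%:R.
pose phi : 'Hom('rV[R]_k.+1, 'rV[R]_n) := linfun (mulmxr P).
have phiE (c : 'rV[R]_k.+1) i : phi c 0 i = c 0 (rho i).
  rewrite lfunE /= mxE (bigD1 (rho i)) //= mxE eqxx mulr1 big1 ?addr0 //.
  move=> a ai.
  by rewrite mxE eq_sym (negPf ai) mulr0.
have ker0 : (lker phi == 0)%VS.
  apply/lker0P => c d cd; apply/rowP => a.
  by rewrite -(sK a) -!phiE cd.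
have dphi : \dim (limg phi) = k.+1.
  by rewrite limg_dim_eq ?(eqP ker0) ?capv0 // dimvf /dim /= mul1n.
pose one : 'rV[R]_n := const_mx 1.
have one0 : one != 0.
  apply/eqP => /rowP/(_ (Ordinal n_gt0)); rewrite !mxE => /eqP.
  by rewrite oner_eq0.
have cap0 : (flat_of x :&: <[one]> = 0)%VS.
  apply/eqP; rewrite -subv0; apply/subvP => y.
  rewrite memv_cap memv0 => /andP[/flat_ofP[yV _] /vlineP[a ya]].
  by apply/eqP/braid_space_const => // i j; rewrite ya !mxE.
have sumE : (flat_of x + <[one]> = limg phi)%VS.
  apply/eqP; rewrite eqEsubv; apply/andP; split.
    rewrite subv_add; apply/andP; split.
      apply/subvP => y /flat_ofP[yV hy].
      have -> : y = phi (\row_a y 0 (sigma a)).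
        apply/rowP => i; rewrite phiE mxE; apply: hy; apply/eqP.
        by rewrite -he sK.
      exact: memv_img (memvf _).
    rewrite -memvE; have -> : one = phi (const_mx 1).
      by apply/rowP => i; rewrite phiE !mxE.
    exact: memv_img (memvf _).
  apply/subvP => _ /memv_imgP[c _ ->].
  (* A block-constant vector is its projection plus its mean times (1, ..., 1). *)
  have -> : phi c = center (phi c) + ((\sum_i phi c 0 i) / n%:R) *: one.
    by apply/rowP => i; rewrite !mxE mulr1 subrK.
  apply: memv_add; last exact/memvZ/memv_line.
  apply/flat_ofP; split; first exact: center_braid.
  move=> i j /eqP; rewrite -he => /eqP rij; apply/eqP.
  by rewrite center_eq !phiE rij.
have := dimv_disjoint_sum cap0.
by rewrite sumE dphi dim_vline one0 addn1 => -[].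
Qed.

(* The points of {0, ..., m-1}^n, projected orthogonally to V: subspaces
   of V are thereby read as subspaces of R^n containing (1, ..., 1). *)
Definition grid_point m (f : {ffun 'I_n -> 'I_m}) : 'rV[R]_n :=
  center (\row_i (f i : nat)%:R).

Lemma grid_point_braid m (f : {ffun 'I_n -> 'I_m}) : grid_point f \in V.
Proof. exact: center_braid. Qed.

Lemma grid_point_lt m (f : {ffun 'I_n -> 'I_m}) i j :
  (grid_point f 0 i < grid_point f 0 j) = (f i < f j)%N.
Proof. by rewrite center_lt !mxE ltr_nat. Qed.

Lemma grid_point_eq m (f : {ffun 'I_n -> 'I_m}) i j :
  (grid_point f 0 i == grid_point f 0 j) = (f i == f j).
Proof. by rewrite center_eq !mxE eqr_nat. Qed.

(** Such an [f] is a free choice of one value per block, and the number of blocks exceeds the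
    dimension by one. *)
Lemma card_grid_flat m x :
  #|[set f : {ffun 'I_n -> 'I_m} | grid_point f \in flat_of x]| =
  (m ^ (\dim (flat_of x)).+1)%N.
Proof.
have [k [rho [sigma [sK h]]]] := rank_coords x n_gt0.
rewrite (dim_flat_of_rank sK h); have he := rank_coords_eq h.
pose F (g : {ffun 'I_k.+1 -> 'I_m}) : {ffun 'I_n -> 'I_m} :=
  [ffun i => g (rho i)].
have injF : injective F.
  move=> g g' /ffunP gg; apply/ffunP => a.
  by have := gg (sigma a); rewrite !ffunE sK.
transitivity #|F @: [set: {ffun 'I_k.+1 -> 'I_m}]|; last first.
  by rewrite card_imset // cardsT card_ffun !card_ord.
apply: eq_card => f; rewrite inE; apply/flat_ofP/imsetP => [[_ hf]|[g _ ->]].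
  exists [ffun a => f (sigma a)] => //; apply/ffunP => i; rewrite !ffunE.
  apply/eqP; rewrite -grid_point_eq; apply/eqP/hf/eqP.
  by rewrite -he sK.
split; first exact: grid_point_braid.
move=> i j /eqP; rewrite -he => /eqP rij; apply/eqP.
by rewrite grid_point_eq !ffunE rij.
Qed.

(** Such an [f] is a strictly increasing choice of one value per block, hence a subset of ['I_m]
    with as many elements as there are blocks. *)
Lemma card_grid_cell m x :
  #|[set f : {ffun 'I_n -> 'I_m} | `[< same_signs x (grid_point f) >]]| =
  'C(m, (\dim (flat_of x)).+1).
Proof.
have [k [rho [sigma [sK h]]]] := rank_coords x n_gt0.
rewrite (dim_flat_of_rank sK h) -card_ltn_sorted_tuples.
have he := rank_coords_eq h.
pose F (t : k.+1.-tuple 'I_m) : {ffun 'I_n -> 'I_m} :=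
  [ffun i => tnth t (rho i)].
have injF : injective F.
  move=> t t' /ffunP tt; apply: eq_from_tnth => a.
  by have := tt (sigma a); rewrite !ffunE sK.
have sortedP (t : k.+1.-tuple 'I_m) : reflect
    (forall a b : 'I_k.+1, (tnth t a < tnth t b)%N = (a < b)%N)
    (sorted ltn (map val t)).
  have nthE (a : 'I_k.+1) : nth 0%N (map val t) a = tnth t a.
    by rewrite (nth_map (tnth t a)) ?size_tuple // -tnth_nth.
  apply: (iffP idP) => [st a b|ht].
    rewrite -!nthE; have := @lt_sorted_ltn_nth _ nat 0%N (map val t) st a b.
    by rewrite !inE size_map size_tuple !ltn_ord => /(_ isT isT).
  apply/(sortedP 0%N) => i; rewrite size_map size_tuple => ik.
  have := ht (Ordinal (ltnW ik)) (Ordinal ik).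
  by rewrite -!nthE /= ltnSn => ->.
rewrite -(card_imset _ injF); apply: eq_card => f.
rewrite inE; apply/asboolP/imsetP => [/same_signsP hf|[t]].
  have fE : f = F [tuple f (sigma a) | a < k.+1].
    apply/ffunP => i; rewrite ffunE tnth_mktuple.
    apply/eqP; rewrite -grid_point_eq.
    by rewrite -(same_signs_eq _ _ (iffRL (same_signsP _ _) hf)) -he sK.
  exists [tuple f (sigma a) | a < k.+1] => //.
  rewrite inE; apply/sortedP => a b.
  by rewrite !tnth_mktuple -grid_point_lt -hf -h !sK.
rewrite inE => /sortedP ht ->; apply/same_signsP => i j.
by rewrite grid_point_lt !ffunE ht h.
Qed.

End Counting.

(** * Cells *)

Section Cells.
Context {R : realType} {n : nat}.
Implicit Types (x y u w : 'rV[R]_n) (X Y : {vspace 'rV[R]_n}).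

Local Notation V := (braid_space R n).

Definition cell x : set 'rV[R]_n := (@unit_sphere R n `&` same_signs x)%classic.

Lemma unit_sphere_scale x : x \in V -> x != 0 ->
  exists2 a, 0 < a & unit_sphere (a *: x).
Proof.
move=> xV x0; pose q := \sum_i x 0 i ^+ 2.
have q0 : 0 < q.
  rewrite lt_neqAle sumr_ge0 ?andbT; last by move=> i _; exact: sqr_ge0.
  apply: contraNneq x0 => /esym/eqP.
  rewrite psumr_eq0; last by move=> i _; exact: sqr_ge0.
  move=> /allP h; apply/eqP/rowP => i; rewrite mxE; apply/eqP.
  by have := h i; rewrite mem_index_enum sqrf_eq0 => /(_ isT).
exists (Num.sqrt q)^-1; first by rewrite invr_gt0 sqrtr_gt0.
split; first exact: memvZ.
under eq_bigr do rewrite !mxE exprMn.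
by rewrite -mulr_sumr exprVn sqr_sqrtr ?ltW // mulVf // gt_eqF.
Qed.

Lemma cell_scale x y : same_signs x y -> y \in V -> y != 0 ->
  exists2 a, 0 < a & cell x (a *: y).
Proof.
move=> xy yV /(unit_sphere_scale yV)[a a0 ay]; exists a => //; split=> //.
exact: same_signs_trans xy (same_signsZ _ a0).
Qed.

Lemma cell0 : cell 0 = set0.
Proof.
apply/seteqP; split=> // y [[yV y1] /(same_signs0 yV) y0].
move: y1; rewrite y0 big1 => [/eqP|i _];
  by rewrite ?mxE ?expr0n // eq_sym oner_eq0.
Qed.

Lemma eq_cellP x y : x \in V -> y \in V -> cell x = cell y <-> same_signs x y.
Proof.
move=> xV yV; split=> [e|xy].
  have [x0|x0] := eqVneq x 0; last first.
    have [a a0] := cell_scale (@same_signs_refl _ _ x) xV x0.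
    move=> h; have [_ xa] := h; move: h; rewrite e => -[_ ya].
    exact: same_signs_trans xa (same_signs_sym ya).
  have [->|y0] := eqVneq y 0; first by rewrite x0.
  have [a a0] := cell_scale (@same_signs_refl _ _ y) yV y0.
  by rewrite -e x0 cell0.
apply/seteqP; split=> z [zS h]; split=> //.
  exact: same_signs_trans (same_signs_sym xy) h.
exact: same_signs_trans xy h.
Qed.

Lemma braid_complexP (C : set 'rV[R]_n) :
  braid_complex C <-> exists2 x, x \in V & C = cell x.
Proof.
split=> [[->|[x [xV _] ->]]|[x xV ->]].
- by exists 0; rewrite ?mem0v ?cell0.
- by exists x.
have [->|x0] := eqVneq x 0; first by left; rewrite cell0.
right; have [a a0 ax] := unit_sphere_scale xV x0.
exists (a *: x) => //; apply/eq_cellP; rewrite ?memvZ //.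
exact: same_signsZ.
Qed.

(* Cells are relatively open in the flats they span. *)
Lemma same_signs_perturb x w : w \in flat_of x ->
  exists a, same_signs x (a *: x + w).
Proof.
case/flat_ofP=> _ hw.
pose q i j := `|w 0 i - w 0 j| / `|x 0 j - x 0 i|.
have q0 i j : 0 <= q i j by rewrite divr_ge0.
pose a := \sum_i \sum_j q i j + 1; exists a.
have aq i j : q i j < a.
  rewrite /a (bigD1 i) //= (bigD1 j) //= -!addrA ltrDl.
  by rewrite ltr_wpDl ?ltr_wpDl ?ltr01 ?sumr_ge0 // => k _; rewrite sumr_ge0.
have lt i j : x 0 i < x 0 j -> (a *: x + w) 0 i < (a *: x + w) 0 j.
  move=> xij; rewrite !mxE -subr_gt0.
  have d0 : 0 < x 0 j - x 0 i by rewrite subr_gt0.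
  have : w 0 i - w 0 j < a * (x 0 j - x 0 i).
    apply: (le_lt_trans (ler_norm _)).
    have := aq i j; rewrite -(ltr_pM2r d0); apply: le_lt_trans.
    by rewrite /q (gtr0_norm d0) divfK // gt_eqF.
  rewrite -subr_gt0; congr (_ < _); ring.
apply/same_signsP => i j; apply/idP/idP; first exact: lt.
case: (ltgtP (x 0 i) (x 0 j)) => // [/lt/ltW|xij].
  by rewrite leNgt => /negPf ->.
by rewrite !mxE xij (hw _ _ xij) ltxx.
Qed.

Lemma span_dim_cell x : x \in V -> span_dim (cell x) = \dim (flat_of x).
Proof.
move=> xV; set C := cell x.
pose P (k : 'I_n.+1) := `[< exists s : k.-tuple 'rV[R]_n,
                              free s /\ forall v, v \in s -> C v >].
have P0 : P ord0.
  by apply/asboolP; exists [tuple]; split; [exact: nil_free|].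
have cP : (0 < #|P|)%N by apply/card_gt0P; exists ord0.
have [k Pk kE] := eq_bigmax_cond (@nat_of_ord n.+1) cP.
have -> : span_dim C = k by exact: kE.
move: Pk => /asboolP[s [fs sC]].
have maxs v : C v -> v \in <<s>>%VS.
  move=> Cv; apply/negPn/negP => vs.
  have fvs : free (v :: s) by rewrite free_cons vs.
  have kn : (k.+1 < n.+1)%N.
    have := dimvS (subvf <<v :: s>>%VS); rewrite (eqnP fvs) /= size_tuple.
    by rewrite dimvf /dim /= mul1n.
  have : (k.+1 <= k)%N.
    rewrite -[leqRHS]kE.
    apply: (@leq_bigmax_cond _ P (@nat_of_ord n.+1) (Ordinal kn)).
    apply/asboolP; exists [tuple of v :: s]; split=> // u.
    by rewrite inE => /orP[/eqP ->|/sC].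
  by rewrite ltnn.
have sameV y : y \in V -> same_signs x y -> y \in <<s>>%VS.
  move=> yV xy; have [->|y0] := eqVneq y 0; first exact: mem0v.
  have [a a0 /maxs] := cell_scale xy yV y0.
  by move/(memvZ a^-1); rewrite scalerA mulVf ?scale1r // gt_eqF.
suff -> : flat_of x = <<s>>%VS by rewrite (eqnP fs) size_tuple.
apply/eqP; rewrite eqEsubv; apply/andP; split.
  apply/subvP => w wx; have [a aw] := same_signs_perturb wx.
  have wV := subvP (flat_of_sub x) _ wx.
  have -> : w = (a *: x + w) - a *: x by rewrite addrC addKr.
  apply: memvB; first by apply: sameV => //; rewrite memvD ?memvZ.
  exact/memvZ/sameV.
apply/span_subvP => v /sC[[vV _] xv].
exact: flat_of_same_signs xv vV (flat_of_id xV).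
Qed.

End Cells.

(** * Embedded arrangements *)

Section EmbeddedArrangement.
Context {R : realType} {n : nat} (n_gt0 : (0 < n)%N).
Context {A : {fset {vspace 'rV[R]_n}}} (A_emb : embedded_in_braid A).
Implicit Types (x y : 'rV[R]_n) (X Y : {vspace 'rV[R]_n}).

Local Notation V := (braid_space R n).

Definition in_union x : bool := has (fun X : {vspace 'rV[R]_n} => x \in X) A.

Lemma in_unionP x : reflect (exists2 X, X \in A & x \in X) (in_union x).
Proof. exact: hasP. Qed.

Lemma finite_link_complex : finite_set (link_complex A).
Proof. by apply: sub_finite_set (@finite_braid_complex R n) => C []. Qed.

Lemma link_cellP x : A != fset0 -> x \in V ->
  link_complex A (cell x) <-> in_union x.
Proof.
move=> /fset0Pn[X0 X0A] xV; split.
  move=> [_ /= h]; have [->|x0] := eqVneq x 0.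
    by apply/in_unionP; exists X0; rewrite ?mem0v.
  have [a a0 ax] := cell_scale (@same_signs_refl _ _ x) xV x0.
  have [X XA aX] := h _ ax; apply/in_unionP; exists X => //.
  by move: (memvZ a^-1 aX); rewrite scalerA mulVf ?scale1r // gt_eqF.
case/in_unionP=> X XA xX; split; first by apply/braid_complexP; exists x.
move=> y [[yV _] xy] /=; exists X => //.
have [z zV Xz] := embedded_flat_of n_gt0 A_emb XA.
by move: xX; rewrite Xz; exact: flat_of_same_signs.
Qed.

Lemma link_complexP (C : set 'rV[R]_n) : A != fset0 ->
  link_complex A C <-> exists x, [/\ x \in V, in_union x & C = cell x].
Proof.
move=> A0; split=> [lC|[x [xV xA ->]]]; last exact/link_cellP.
have [/braid_complexP[x xV Cx] _] := lC; exists x; split=> //.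
by apply/link_cellP => //; rewrite -Cx.
Qed.

Lemma complex_rank_link : A != fset0 ->
  complex_rank (link_complex A) = arrangement_dim A.
Proof.
move=> A0; apply/eqP; rewrite eqn_leq; apply/andP; split.
  apply/bigmax_leqP_seq => C.
  rewrite in_fset_set; last exact: finite_link_complex.
  rewrite inE => /(link_complexP _ A0)[x [xV /in_unionP[X XA xX] ->]] _.
  rewrite span_dim_cell //.
  have [z zV Xz] := embedded_flat_of n_gt0 A_emb XA.
  apply: (@leq_trans (\dim X)); last exact: leq_bigmax_seq.
  by apply: dimvS; rewrite Xz flat_of_min // -Xz.
apply/bigmax_leqP_seq => X XA _.
have [z zV Xz] := embedded_flat_of n_gt0 A_emb XA.
rewrite Xz -(span_dim_cell zV); apply: leq_bigmax_seq => //.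
rewrite in_fset_set ?inE; last exact: finite_link_complex.
apply/link_complexP => //; exists z; split=> //.
by apply/in_unionP; exists X; rewrite // Xz flat_of_id.
Qed.

Lemma num_facesE (D : set (set 'rV[R]_n)) k : finite_set D ->
  num_faces D k = (\sum_(C <- fset_set D | span_dim C == k) 1)%N.
Proof.
move=> fD; rewrite big_fset_condE -card_fset_sum1; congr #|` _|.
apply/fsetP => C; rewrite !inE !in_fset_set //; last exact: finite_setIl.
by apply/idP/andP; rewrite !inE => -[DC /eqP h].
Qed.

Lemma card_grid_union m : A != fset0 ->
  let D := link_complex A in
  #|[set f : {ffun 'I_n -> 'I_m} | in_union (grid_point (R := R) f)]| =
  (\sum_(i < (complex_rank D).+1) num_faces D i * 'C(m, i.+1))%N.
Proof.
move=> A0 D; have fD : finite_set D := finite_link_complex.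
transitivity (\sum_(C <- fset_set D) 'C(m, (span_dim C).+1))%N; last first.
  under [RHS]eq_bigr do rewrite num_facesE // big_distrl /=.
  under [RHS]eq_bigr do rewrite big_mkcond.
  rewrite exchange_big /= big_seq [RHS]big_seq; apply: eq_bigr => C CD.
  have Cd : (span_dim C < (complex_rank D).+1)%N.
    by rewrite ltnS; exact: leq_bigmax_seq.
  rewrite (bigD1 (Ordinal Cd)) //= eqxx mul1n big1 ?addn0 // => i.
  by rewrite -val_eqE /= eq_sym => /negPf ->.
transitivity (\sum_(f : {ffun 'I_n -> 'I_m})
    \sum_(C <- fset_set D) (cell (grid_point (R := R) f) == C))%N.
  rewrite -sum1_card big_mkcond /=; apply: eq_bigr => f _.
  transitivity (cell (grid_point (R := R) f) \in fset_set D : nat).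
    have fP := link_cellP A0 (grid_point_braid n_gt0 f).
    rewrite inE in_fset_set // (_ : (_ \in D) = in_union (grid_point f)).
      by case: in_union.
    by apply/idP/idP => [/set_mem/fP|/fP/mem_set].
  rewrite -count_uniq_mem ?fset_uniq // -sum1_count big_mkcond /=.
  by apply: eq_bigr => C _; rewrite eq_sym; case: eqP.
rewrite exchange_big /= big_seq [RHS]big_seq; apply: eq_bigr => C.
rewrite in_fset_set // inE => /(link_complexP _ A0)[x [xV _ ->]].
rewrite span_dim_cell // -card_grid_cell // -sum1_card [RHS]big_mkcond /=.
apply: eq_bigr => f _; rewrite inE.
have := eq_cellP xV (grid_point_braid n_gt0 f).
case: eqP => [e|ne] [h1 h2]; first by rewrite asboolT //; exact: h1.
by rewrite asboolF // => /h2/esym.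
Qed.

Lemma sum_mobius_grid_point m (f : {ffun 'I_n -> 'I_m}) : V \notin A ->
  let L := intersection_lattice A in
  \sum_(Y <- L | grid_point f \in Y) mobius L (@reverse_inclusion R n) V Y =
  (~~ in_union (grid_point f))%:R.
Proof.
move=> VA L; set x := grid_point f.
have xV : x \in V := grid_point_braid n_gt0 f.
pose B := [fset X in A | x \in X]%fset.
pose Yx := (V :&: \bigcap_(X <- B) X)%VS.
have YxL : Yx \in L.
  apply/intersection_latticeP; exists B => //.
  by apply/fsubsetP => X; rewrite !inE => /andP[].
have xYx : x \in Yx.
  rewrite memv_cap xV memv_bigcap_seq; apply/allP => X.
  by rewrite !inE => /andP[].
have VL : V \in L.
  apply/intersection_latticeP; exists fset0; rewrite ?fsub0set //.
  by rewrite big_seq_fset0 capvf.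
have LV Y : Y \in L -> (Y <= V)%VS.
  by case/intersection_latticeP=> B' _ ->; exact: capvSl.
have YxP Y : Y \in L -> (x \in Y) = (Yx <= Y)%VS.
  move=> YL; apply/idP/idP => [|/subvP]; last by apply.
  case/intersection_latticeP: YL => B' /fsubsetP B'A ->.
  rewrite memv_cap memv_bigcap_seq => /andP[_ /allP hB'].
  apply/subvP => y; rewrite !memv_cap !memv_bigcap_seq => /andP[-> /allP hy].
  by apply/allP => X XB'; apply: hy; rewrite !inE B'A ?hB'.
have -> : \sum_(Y <- L | x \in Y) mobius L (@reverse_inclusion R n) V Y =
    \sum_(Y <- L | reverse_inclusion V Y && reverse_inclusion Y Yx)
       mobius L (@reverse_inclusion R n) V Y.
  rewrite big_seq_cond [RHS]big_seq_cond; apply: eq_bigl => Y.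
  rewrite /reverse_inclusion; case YL: (Y \in L) => //=.
  by rewrite YxP // LV.
have [YV|nYV] := eqVneq Yx V; last first.
  rewrite mobius_sum //.
  - suff -> : in_union x by [].
    apply/negPn; apply: contra nYV => /hasPn nA.
    rewrite /Yx (_ : B = fset0) ?big_seq_fset0 ?capvf //.
    apply/fsetP => X; rewrite !inE; case XA: (X \in A) => //=.
    exact/negbTE/nA.
  - by move=> Y; exact: subvv.
  - by move=> Y Z W ZY YW; exact: subv_trans YW ZY.
  - by move=> Y Z h; apply/subv_anti; rewrite andbC.
  - exact: LV.
  - by rewrite eq_sym.
have -> : in_union x = false.
  apply/negP => /in_unionP[X XA xX].
  have XV : (X <= V)%VS.
    by have [z _ ->] := embedded_flat_of n_gt0 A_emb XA; exact: flat_of_sub.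
  suff XE : X = V by rewrite -XE XA in VA.
  apply/eqP; rewrite eqEsubv XV -YV; apply: subv_trans (capvSr _ _) _.
  have XB : X \in B by rewrite !inE XA.
  apply/subvP => y; rewrite memv_bigcap_seq => /allP; exact.
rewrite YV -big_filter (_ : [seq _ <- _ | _] = [:: V]).
  by rewrite big_seq1 mobius_diag.
apply: perm_small_eq => //; apply: uniq_perm => //.
  by rewrite filter_uniq // fset_uniq.
move=> Y; rewrite mem_filter !inE /reverse_inclusion -eqEsubv.
by case: eqVneq => [->|]//=; rewrite VL.
Qed.

Lemma tail_grid_union m : V \notin A ->
  m%:R * (tail A).[m%:R] =
  #|[set f : {ffun 'I_n -> 'I_m} | in_union (grid_point (R := R) f)]|%:R :> int.
Proof.
move=> VA.
pose U := [set f : {ffun 'I_n -> 'I_m} | in_union (grid_point (R := R) f)].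
have cU : (#|U| + #|~: U| = m ^ n)%N by rewrite cardsC card_ffun !card_ord.
suff chiE : m%:R * (char_poly_arr A).[m%:R] = #|~: U|%:R :> int.
  rewrite /tail hornerD hornerN hornerXn mulrBr chiE -exprS prednK //.
  by rewrite -natrX -cU natrD addrK.
rewrite /char_poly_arr horner_sum mulr_sumr.
transitivity (\sum_(f : {ffun 'I_n -> 'I_m})
    (~~ in_union (grid_point (R := R) f))%:R : int); last first.
  rewrite -sum1_card natr_sum [RHS]big_mkcond /=; apply: eq_bigr => f _.
  by rewrite !inE; case: in_union.
under [RHS]eq_bigr do rewrite -sum_mobius_grid_point // big_mkcond /=.
rewrite exchange_big /= big_seq [RHS]big_seq; apply: eq_bigr => Y YL.
rewrite -big_mkcond sumr_const hornerZ hornerXn.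
have [x _ Yx] := lattice_flat_of n_gt0 A_emb YL.
rewrite -[in RHS]mulr_natl mulrCA [RHS]mulrC; congr (_ * _).
rewrite -exprS -natrX; congr _%:R.
rewrite Yx -(card_grid_flat n_gt0) -Yx.
by apply: eq_card => f; rewrite inE.
Qed.

End EmbeddedArrangement.

Theorem theorem5p5 (R : realType) (n : nat) (n_gt0 : (0 < n)%N)
    (A : {fset {vspace 'rV[R]_n}})
    (A_embedded : embedded_in_braid A)
    (A_proper : braid_space R n \notin A) :
  expansion ('X * hbar_arr A) ((1 - 'X) ^+ (arrangement_dim A + 2))
    (fun m : nat => m%:R * (tail A).[m%:R]).
Proof.
have tE := tail_grid_union n_gt0 A_embedded ^~ A_proper.
rewrite /hbar_arr; case: (eqVneq A fset0) => [A0|A0] N.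
  rewrite mulr0 coef0 big1 // => i _; rewrite tE.
  rewrite (_ : [set f | _] = finset.set0) ?cards0 ?mulr0 //.
  by apply/setP => f; rewrite !inE /in_union A0.
rewrite -(complex_rank_link n_gt0 A_embedded A0) -expansion_hbar.
apply: eq_bigr => i _; rewrite tE card_grid_union // natr_sum.
by congr (_ * _); apply: eq_bigr => j _; rewrite natrM.
Qed.
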